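(* Let $r,n\geq 1$ and let $a\in\overline{\mathbb{F}}_q[T]$ be monic of degree $n$ with factorization $a=(T-\alpha_1)\cdots(T-\alpha_n)$, where $\alpha_1,\ldots,\alpha_n\in\overline{\mathbb{F}}_q$ are not necessarily distinct. The polynomial $f_a\in\overline{\mathbb{F}}_q[T_1,\ldots,T_r]$ defined in the context satisfies the following properties. (1) If $r,n\geq 2$ and $1\leq l\leq r$, then $$f_a(T_1,\ldots,T_r)=\bigg(\prod_{\substack{j=1\\ j\neq l}}^r(T_j-\alpha_1)\bigg)f_{a/(T-\alpha_1)}(T_1,\ldots,T_r)+\bigg(\prod_{i=2}^n(T_l-\alpha_i)\bigg)f_a(T_1,\ldots,\widehat{T}_l,\ldots,T_r),$$ where $f_{a/(T-\alpha_1)}$ is formed with the ordering $\alpha_2,\ldots,\alpha_n$ of the roots of $a/(T-\alpha_1)$, and $f_a(T_1,\ldots,\widehat{T}_l,\ldots,T_r)$ is the polynomial $f_a$ for $r-1$ variables, evaluated at $T_1,\ldots,T_{l-1},T_{l+1},\ldots,T_r$. (2) The polynomial $f_a(T_1,\ldots,T_r)$ is symmetric in $T_1,\ldots,T_r$. (3) For every permutation $\sigma\in S_n$, put $$f_a^\sigma(T_1,\ldots,T_r):=\sum_{1=i_0\leq\cdots\leq i_r=n}\ \prod_{j=1}^r\frac{a(T_j)}{(T_j-\alpha_{\sigma(i_{j-1})})\cdots(T_j-\alpha_{\sigma(i_j)})},$$ where the denominator is $\prod_{i=i_{j-1}}^{i_j}(T_j-\alpha_{\sigma(i)})$. Then $f_a=f_a^\sigma$;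 that is, $f_a$ does not depend on the order in which the roots $\alpha_1,\ldots,\alpha_n$ are labeled. (4) If $a\in\mathbb{F}_q[T]$, then all coefficients of $f_a$ lie in $\mathbb{F}_q$.
   Context: Let $q$ be a prime power and $\overline{\mathbb{F}}_q$ an algebraic closure of $\mathbb{F}_q$. For integers $r,n\geq 1$ and a monic $a\in\overline{\mathbb{F}}_q[T]$ of degree $n$ with an ordered factorization $a=(T-\alpha_1)\cdots(T-\alpha_n)$, define $$f_a(T_1,\ldots,T_r):=\sum_{1=i_0\leq\cdots\leq i_r=n}\ \prod_{j=1}^r\frac{a(T_j)}{(T_j-\alpha_{i_{j-1}})\cdots(T_j-\alpha_{i_j})}=\sum_{1=i_0\leq\cdots\leq i_r=n}\ \prod_{j=1}^r\ \prod_{\substack{1\leq i\leq n\\ i\notin[i_{j-1},i_j]}}(T_j-\alpha_i)\in\overline{\mathbb{F}}_q[T_1,\ldots,T_r].$$ The sum is over integer tuples $(i_0,\ldots,i_r)$ with $1=i_0\leq i_1\leq\cdots\leq i_r=n$; the denominator means $\prod_{i=i_{j-1}}^{i_j}(T_j-\alpha_i)$, which is the single factor $T_j-\alpha_{i_j}$ when $i_{j-1}=i_j$. The number of variables $r$ is part of the definition of $f_a$ and is indicated by the list of arguments. *)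

(* Defs.v *)
From HB Require Import structures.
From mathcomp Require Export all_boot all_fingroup all_algebra.
From mathcomp Require Export mpoly.

Set Implicit Arguments.
Unset Strict Implicit.
Unset Printing Implicit Defensive.

Import GRing.Theory.
Local Open Scope ring_scope.

Section FA.
Variables (K : fieldType) (r n : nat).
Implicit Types (alpha : n.-tuple K) (i : {ffun 'I_r.+1 -> 'I_n}) (j : 'I_r).

(* The roots alpha_1, ..., alpha_n are numbered from 0 here, so that an index
   tuple satisfies 0 = i_0 <= ... <= i_r = n - 1; the variables T_1, ..., T_r
   are 'X_0, ..., 'X_(r-1). Accordingly j : 'I_r stands for the j.+1-st factor
   of a summand, whose interval runs from lo i j = i_j to hi i j = i_(j+1). *)
Definition lo i j : 'I_n := i (widen_ord (leqnSn r) j).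
Definition hi i j : 'I_n := i (lift ord0 j).

Definition chain i : bool :=
  [&& i ord0 == 0%N :> nat, i ord_max == n.-1 :> nat
    & [forall j, (lo i j <= hi i j)%N]].

Definition fa alpha : {mpoly K[r]} :=
  \sum_(i | chain i) \prod_(j < r)
    \prod_(k < n | ~~ (lo i j <= k <= hi i j)%N) ('X_j - (tnth alpha k)%:MP).

Definition eval_var (a : {poly K}) j : {mpoly K[r]} :=
  (map_poly (@mpolyC r K) a).['X_j].

Definition fa_perm (a : {poly K}) alpha (sigma : 'S_n) :
    {fraction {mpoly K[r]}} :=
  \sum_(i | chain i) \prod_(j < r)
    (tofrac (eval_var a j) /
     tofrac (\prod_(k < n | (lo i j <= k <= hi i j)%N)
               ('X_j - (tnth alpha (sigma k))%:MP))).

Lemma eval_var_prod alpha j :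
  eval_var (\prod_(k < n) ('X - (tnth alpha k)%:P)) j =
  \prod_(k < n) ('X_j - (tnth alpha k)%:MP).
Proof.
rewrite /eval_var rmorph_prod horner_prod; apply: eq_bigr => k _.
by rewrite rmorphB /= map_polyX map_polyC !hornerE.
Qed.

Lemma XsubC_neq0 j (c : K) : 'X_j - c%:MP != 0 :> {mpoly K[r]}.
Proof.
apply/eqP => /(congr1 (mcoeff U_(j))).
rewrite mcoeffB mcoeffX eqxx mcoeffC mcoeff0 mnm1_eq0 mulr0 subr0.
by move/eqP; rewrite oner_eq0.
Qed.

(* The two expressions defining f_a agree. *)
Lemma fa_frac alpha :
  tofrac (fa alpha) = fa_perm (\prod_(k < n) ('X - (tnth alpha k)%:P)) alpha 1%g.
Proof.
rewrite rmorph_sum; apply: eq_bigr => i _; rewrite rmorph_prod.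
apply: eq_bigr => j _; rewrite eval_var_prod.
under [X in _ / tofrac X]eq_bigr do rewrite perm1.
rewrite [X in tofrac X / _](bigID (fun k : 'I_n => (lo i j <= k <= hi i j)%N)) /=.
rewrite tofracM mulrC mulKf // tofrac_eq0.
by apply/prodf_neq0 => k _; exact: XsubC_neq0.
Qed.

End FA.
Arguments fa {K} r {n} alpha.
Arguments fa_perm {K} r {n} a alpha sigma.

(* Main.v *)
Require Import Defs.
From mathcomp Require Import ring.

(** Let [B_A(x) = (A(X) - A(x)) / (X - x)] and let [N_s] be the product of the
    first [s] factors [X - alpha_i] of [A].  In the Newton basis [N_0, ...,
    N_(n-1)] of the quotient by [A], multiplication by [B_A(x)] is the upper
    triangular matrix whose [(s, k)] entry is the product of the [x - alpha_i]
    over [i] outside [[s, k]].  Hence the sum over chains defining [f_a] is the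
    [(0, n-1)] entry of a product of such matrices, i.e. the coefficient of
    [X^(n-1)] in the remainder of [prod_j B_A(T_j)] modulo [A].  This expression
    is symmetric in the [T_j], depends only on [A], and is defined over any ring
    containing the coefficients of [A].  The recursion follows from the two
    product rules for [B_((X - c) A)(x)]. *)

Set Implicit Arguments.
Unset Strict Implicit.
Unset Printing Implicit Defensive.
Import GRing.Theory Pdiv.CommonRing Pdiv.RingMonic.
Local Open Scope ring_scope.

(** * Divided differences and remainders modulo a monic polynomial *)

Section DividedDifference.
Variable R : comNzRingType.
Implicit Types (p q A D : {poly R}) (x c : R).

Definition divdiff A x : {poly R} := rdivp (A - A.[x]%:P) ('X - x%:P).

Lemma divdiffK A x : divdiff A x * ('X - x%:P) = A - A.[x]%:P.
Proof.
rewrite rdivpK ?monicXsubC //; apply/rdvdpP; first exact: monicXsubC.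
by apply/factor_theorem; rewrite rootE !hornerE subrr.
Qed.

Lemma mul_XsubC_inj x p q : p * ('X - x%:P) = q * ('X - x%:P) -> p = q.
Proof. by move/(monic_rreg (monicXsubC x)). Qed.

Lemma divdiff_uniq A x q : q * ('X - x%:P) = A - A.[x]%:P -> q = divdiff A x.
Proof. by rewrite -divdiffK; apply: mul_XsubC_inj. Qed.

(** Times [X - x], this rule and the next both give [(X - c) A(X) - (x - c) A(x)]. In the recursion,
    this one treats the distinguished variable and the next one all the others. *)
Lemma divdiff_XsubCMl A c x :
  divdiff (('X - c%:P) * A) x = A.[x]%:P + ('X - c%:P) * divdiff A x.
Proof.
apply/esym/divdiff_uniq; rewrite mulrDl -mulrA divdiffK !hornerE polyCM polyCB.
by ring.
Qed.

Lemma divdiff_XsubCMr A c x :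
  divdiff (('X - c%:P) * A) x = A + (x - c)%:P * divdiff A x.
Proof.
apply/esym/divdiff_uniq; rewrite mulrDl -mulrA divdiffK !hornerE polyCM polyCB.
by ring.
Qed.

Lemma rmodp_eqP A p q : A \is monic ->
  rmodp p A = rmodp q A <-> exists D, p - q = D * A.
Proof.
move=> mA; split=> [e|[D e]].
  exists (rdivp p A - rdivp q A).
  by rewrite {1}(rdivp_eq mA p) {1}(rdivp_eq mA q) e; ring.
by apply/eqP; rewrite -subr_eq0 -rmodpB // e rmodp_mull.
Qed.

Lemma rmodp_mulml A p q : A \is monic -> rmodp (rmodp p A * q) A = rmodp (p * q) A.
Proof. by move=> mA; rewrite mulrC rmodp_mulmr // mulrC. Qed.

(** The right-hand side has smaller degree than [(X - c) A], so it is already reduced. *)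
Lemma rmodp_XsubCM A c p : A \is monic ->
  rmodp (('X - c%:P) * p) (('X - c%:P) * A) = ('X - c%:P) * rmodp p A.
Proof.
move=> mA; have mXA : ('X - c%:P) * A \is monic by rewrite monicMl // monicXsubC.
rewrite {1}(rdivp_eq mA p) mulrDr mulrCA rmodp_addl_mul_small //.
rewrite [X in (_ < X)%N]size_monicM ?monicXsubC ?monic_neq0 // size_XsubC.
have [->|nz] := eqVneq (rmodp p A) 0.
  by rewrite mulr0 size_poly0.
rewrite size_monicM ?monicXsubC // size_XsubC /= ltnS.
by rewrite ltn_rmodp monic_neq0.
Qed.

End DividedDifference.

(** * Base change along ring morphisms *)

Section Morphism.
Variables (R S : comNzRingType) (f : {rmorphism R -> S}).

Lemma map_divdiff A x :
  map_poly f (divdiff A x) = divdiff (map_poly f A) (f x).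
Proof.
apply: divdiff_uniq; move/(congr1 (map_poly f)): (divdiffK A x).
by rewrite rmorphM !rmorphB /= map_polyX !map_polyC horner_map.
Qed.

Lemma map_rmodp p A : A \is monic ->
  map_poly f (rmodp p A) = rmodp (map_poly f p) (map_poly f A).
Proof.
move=> mA; rewrite {2}(rdivp_eq mA p) rmorphD rmorphM rmodp_addl_mul_small //.
  exact: monic_map.
(* The image of [A] keeps its size because its leading coefficient 1 maps to 1. *)
rewrite [X in (_ < X)%N]size_poly_eq -?lead_coefE ?(monicP mA) ?rmorph1
  ?oner_neq0 //.
by apply: leq_ltn_trans (size_poly _ _) _; rewrite ltn_rmodp monic_neq0.
Qed.

End Morphism.

(** * Chain sums as coefficients of remainders, via the Newton basis *)

Section ChainSum.
Variable R : comNzRingType.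
Implicit Types (x : R) (al : nat -> R).

(** This is [fa] with arbitrary ring elements for the variables and roots. Indexing the roots by
    [nat] makes removal of the first one the shift [al \o succn]. *)
Definition chain_sum r n (x : 'I_r -> R) al : R :=
  \sum_(i : {ffun 'I_r.+1 -> 'I_n} | chain i) \prod_(j < r)
    \prod_(k < n | ~~ (lo i j <= k <= hi i j)%N) (x j - al k).

Definition newton al s : {poly R} := \prod_(k < s) ('X - (al k)%:P).

Lemma monic_newton al s : newton al s \is monic.
Proof. exact: monic_prod_XsubC. Qed.

Lemma size_newton al s : size (newton al s) = s.+1.
Proof. by rewrite size_prod_XsubC /index_enum -enumT size_enum_ord. Qed.

Lemma newtonS al s : newton al s.+1 = newton al s * ('X - (al s)%:P).
Proof. exact: big_ord_recr. Qed.

(** The value 0 below the diagonal lets sums run over all index tuples, since those with a descent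
    then vanish. *)
Definition weight n al x (s k : nat) : R :=
  if (s <= k)%N then \prod_(m < n | ~~ (s <= m <= k)%N) (x - al m) else 0.

Lemma rmodp_newton_divdiff n al x (s : 'I_n) :
  rmodp (newton al s * divdiff (newton al n) x) (newton al n) =
  rmodp (\sum_(k < n) weight n al x s k *: newton al k) (newton al n).
Proof.
apply/rmodp_eqP; first exact: monic_newton.
(* After multiplication by [X - x] the sum telescopes. *)
exists (divdiff (newton al s) x); apply: (@mul_XsubC_inj _ x).
(* For [s <= k], the weight is [W k.+1], and [X - x = (X - al k) - (x - al k)] turns the k-th term
   into [W k.+1 *: newton al k.+1 - W k *: newton al k]. *)
pose W (k : nat) := \prod_(m < n | ~~ (s <= m < k)%N) (x - al m).
have WS (k : 'I_n) : (s <= k)%N -> W k = W k.+1 * (x - al k).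
  move=> sk; rewrite /W (bigD1 k) ?ltnn ?andbF //= mulrC; congr (_ * _).
  apply: eq_bigl => m; have [->|ne] := eqVneq m k; first by rewrite sk leqnn andbF.
  by rewrite andbT ltnS (leq_eqVlt m) val_eqE (negPf ne).
have sumE : (\sum_(k < n) weight n al x s k *: newton al k) * ('X - x%:P)
    = W n *: newton al n - W s *: newton al s.
  have le_sn : (s <= n)%N by apply: ltnW.
  rewrite -(telescope_sumr (fun k => W k *: newton al k) le_sn).
  rewrite mulr_suml big_geq_mkord [RHS]big_mkcond; apply: eq_bigr => k _ /=.
  rewrite /weight; case: ifP => sk; last by rewrite scale0r mul0r.
  rewrite (WS k sk) newtonS -!mul_polyC polyCM polyCB -/(W k.+1).
  by ring.
rewrite mulrBl sumE -(mulrA (newton al s)) (mulrAC _ (newton al n)).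
rewrite !divdiffK -!mul_polyC.
(* [W n] keeps only the indices below [s], whereas [W s] omits an empty interval and keeps them
   all. *)
have -> : W n = (newton al s).[x].
  rewrite /newton horner_prod.
  rewrite (big_ord_widen n (fun k => ('X - (al k)%:P).[x])) 1?ltnW //.
  by apply: eq_big => k; [rewrite ltn_ord andbT -ltnNge | rewrite !hornerE].
have -> : W s = (newton al n).[x].
  rewrite /W /newton horner_prod; apply: eq_big => k; last by rewrite !hornerE.
  by case: leqP.
by ring.
Qed.

Definition path_cons r n (s : 'I_n) (i : {ffun 'I_r.+1 -> 'I_n}) :
    {ffun 'I_r.+2 -> 'I_n} :=
  [ffun k => oapp i s (unlift ord0 k)].

Lemma lo_cons0 r n (s : 'I_n) (i : {ffun 'I_r.+1 -> 'I_n}) :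
  lo (path_cons s i) ord0 = s.
Proof.
rewrite /lo ffunE (_ : widen_ord _ _ = ord0) ?unlift_none //; exact: val_inj.
Qed.

Lemma hi_cons0 r n (s : 'I_n) (i : {ffun 'I_r.+1 -> 'I_n}) :
  hi (path_cons s i) ord0 = i ord0.
Proof. by rewrite /hi ffunE liftK. Qed.

Lemma lo_consS r n (s : 'I_n) (i : {ffun 'I_r.+1 -> 'I_n}) j :
  lo (path_cons s i) (lift ord0 j) = lo i j.
Proof.
rewrite /lo ffunE (_ : widen_ord _ _ = lift ord0 (widen_ord (leqnSn r) j)).
  by rewrite liftK.
exact: val_inj.
Qed.

Lemma hi_consS r n (s : 'I_n) (i : {ffun 'I_r.+1 -> 'I_n}) j :
  hi (path_cons s i) (lift ord0 j) = hi i j.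
Proof. by rewrite /hi ffunE liftK. Qed.

Lemma path_cons_max r n (s : 'I_n) (i : {ffun 'I_r.+1 -> 'I_n}) :
  path_cons s i ord_max = i ord_max.
Proof.
rewrite ffunE (_ : ord_max = lift ord0 ord_max) ?liftK //; exact: val_inj.
Qed.

Lemma big_path_cons r n (V : nmodType) (s : 'I_n)
    (F : {ffun 'I_r.+2 -> 'I_n} -> V) :
  \sum_(i : {ffun 'I_r.+2 -> 'I_n} | i ord0 == s) F i = \sum_i F (path_cons s i).
Proof.
rewrite (reindex_onto (path_cons s) (fun i => [ffun k => i (lift ord0 k)])) /=.
  apply: eq_bigl => i; rewrite ffunE unlift_none /= eqxx; apply/eqP/ffunP => k.
  by rewrite !ffunE liftK.
move=> i /eqP i0; apply/ffunP => k; rewrite ffunE.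
by case: unliftP => [j|] -> /=; rewrite ?ffunE ?i0.
Qed.

(** Row [s] of a product of [r] matrices, expanded over paths: the first factor chooses the next
    index, and the induction hypothesis continues from there. *)
Lemma rmodp_newton_prod_divdiff r n (x : 'I_r -> R) al (s : 'I_n) :
  rmodp (newton al s * \prod_j divdiff (newton al n) (x j)) (newton al n) =
  rmodp (\sum_(i : {ffun 'I_r.+1 -> 'I_n} | i ord0 == s)
    (\prod_j weight n al (x j) (lo i j) (hi i j)) *: newton al (i ord_max))
    (newton al n).
Proof.
have mA := monic_newton al n.
elim: r => [|r IH] in x s *.
  rewrite big_ord0 mulr1 (big_pred1 [ffun=> s]) => [|i].
    by rewrite big_ord0 scale1r ffunE.
  apply/eqP/eqP => [i0|->]; last by rewrite ffunE.
  by apply/ffunP => k; rewrite ffunE (ord1 k).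
rewrite big_ord_recl mulrA -rmodp_mulml // rmodp_newton_divdiff rmodp_mulml //.
rewrite mulr_suml rmodp_sum //.
under eq_bigr do rewrite -scalerAl rmodpZ // IH -rmodpZ //.
rewrite -rmodp_sum // big_path_cons; congr (rmodp _ _).
rewrite [RHS](partition_big (fun i : {ffun 'I_r.+1 -> 'I_n} => i ord0) xpredT) //=.
apply: eq_bigr => k _; rewrite scaler_sumr; apply: eq_bigr => i /eqP ik.
rewrite big_ord_recl lo_cons0 hi_cons0 path_cons_max ik scalerA.
by under [in RHS]eq_bigr do rewrite lo_consS hi_consS.
Qed.

(** Taking this coefficient selects the paths that end at the last index. *)
Lemma coef_newton al n k : (k < n)%N -> (newton al k)`_n.-1 = (k == n.-1)%:R.
Proof.
case: n => // n; rewrite ltnS /= leq_eqVlt => /predU1P[->|lt_kn].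
  rewrite eqxx; move: (monicP (monic_newton al n)).
  by rewrite lead_coefE size_newton.
by rewrite (ltn_eqF lt_kn) nth_default // size_newton.
Qed.

Lemma chain_sumE r n (x : 'I_r -> R) al : (0 < n)%N ->
  chain_sum n x al =
  (rmodp (\prod_j divdiff (newton al n) (x j)) (newton al n))`_n.-1.
Proof.
case: n => // n _; set A := newton al n.+1.
rewrite -[X in rmodp X]mul1r.
rewrite -[X in X * _](_ : newton al (ord0 : 'I_n.+1) = 1); last first.
  by rewrite /newton big_ord0.
(* Paths start at index 0, where the Newton polynomial is 1. Their sum is already reduced, as every
   end index is below [n.+1]. *)
rewrite rmodp_newton_prod_divdiff rmodp_small; last first.
  rewrite size_newton ltnS; apply: (leq_trans (size_sum _ _ _)).
  apply/bigmax_leqP => i _; apply: (leq_trans (size_scale_leq _ _)).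
  by rewrite size_newton.
rewrite coef_sum /chain_sum big_mkcond [RHS]big_mkcond /=.
apply: eq_bigr => i _; rewrite coefZ (@coef_newton al n.+1) // /chain.
rewrite -val_eqE /=; case: (_ == 0)%N => //=.
case: eqP => _ /=; last by rewrite mulr0.
rewrite mulr1; case: ifPn => [/forallP mono|].
  by apply: eq_bigr => j _; rewrite /weight mono.
(* A descent at [j] contributes a zero weight. *)
rewrite negb_forall => /existsP[j /negPf nle].
by rewrite (bigD1 j) //= /weight nle mul0r.
Qed.

End ChainSum.

(** * The recursion that removes the first root *)

Section Recursion.
Variable R : comNzRingType.

(** Each factor on the left is [A + (y i - c) B_A(y i)], and the factor [X - c] in front makes the
    summand [A] vanish modulo [(X - c) A]. *)
Lemma rmodp_XsubCM_prod_divdiff r (A : {poly R}) c (y : 'I_r -> R) :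
  A \is monic ->
  rmodp (('X - c%:P) * \prod_i divdiff (('X - c%:P) * A) (y i)) (('X - c%:P) * A) =
  rmodp (('X - c%:P) * (\prod_i (y i - c) *: \prod_i divdiff A (y i)))
        (('X - c%:P) * A).
Proof.
move=> mA; apply/rmodp_eqP; first by rewrite monicMl ?monicXsubC.
elim/big_rec3: _ => [|i P q Q _ [D eD]].
  by exists 0; rewrite scale1r subrr mul0r.
(* The summand [A] of the new factor adds the product [Q] of the earlier factors to the quotient;
   the other summand multiplies the old quotient [D]. *)
exists (Q + (y i - c)%:P * divdiff A (y i) * D).
rewrite [in RHS]mulrDl -[in RHS]mulrA -eD divdiff_XsubCMr -!mul_polyC polyCM.
by ring.
Qed.

Lemma chain_sum_rec r n (x : 'I_r.+1 -> R) al l : (0 < n)%N ->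
  chain_sum n.+1 x al =
  (\prod_i (x (lift l i) - al 0%N)) * chain_sum n x (al \o succn)
  + (\prod_(k < n) (x l - al k.+1)) * chain_sum n.+1 (x \o lift l) al.
Proof.
move=> n_gt0; rewrite !chain_sumE //=; set b := newton (al \o succn) n.
have mb : b \is monic by apply: monic_newton.
have -> : newton al n.+1 = ('X - (al 0%N)%:P) * b by rewrite /newton big_ord_recl.
have -> : \prod_(k < n) (x l - al k.+1) = b.[x l].
  by rewrite /b /newton horner_prod; apply: eq_bigr => k _; rewrite !hornerE.
set A := _ * b; have mA : A \is monic by rewrite monicMl ?monicXsubC.
(* The constant [b.[x l]] yields the chain sum without the variable [l]; the multiple of [X - al 0]
   yields the one without the first root. *)
rewrite (bigD1_ord l) //= (divdiff_XsubCMl b (al 0%N) (x l) : divdiff A _ = _).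
set Q := \prod_(i < r) divdiff A _.
rewrite (mulrDl _ _ Q) rmodpD // mul_polyC rmodpZ // coefD coefZ addrC.
congr (_ + _); rewrite mulrAC -rmodp_mulml // rmodp_XsubCM_prod_divdiff //.
rewrite rmodp_mulml // -mulrA -scalerAl rmodp_XsubCM // rmodpZ //.
rewrite (bigD1_ord l) //= [divdiff b _ * _]mulrC -scalerAr coefZ; congr (_ * _).
rewrite mulrBl coefB coefXM coefCM.
(* A remainder modulo [b] has no coefficient of degree [n], so the coefficient of degree [n] in its
   product with [X - al 0] is its coefficient of degree [n.-1]. *)
rewrite [X in _ - _ * X]nth_default ?mulr0 ?subr0.
  by case: (n) n_gt0.
by rewrite -ltnS -[X in (_ < X)%N](size_newton (al \o succn)) ltn_rmodp monic_neq0.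
Qed.

End Recursion.

(** * Substitution, symmetry and dependence on the roots *)

Section MorphismChainSum.
Variables (R S : comNzRingType) (f : {rmorphism R -> S}).

Lemma rmorph_chain_sum r n (x : 'I_r -> R) al :
  f (chain_sum n x al) = chain_sum n (f \o x) (f \o al).
Proof.
rewrite rmorph_sum; apply: eq_bigr => i _; rewrite rmorph_prod.
apply: eq_bigr => j _; rewrite rmorph_prod.
by apply: eq_bigr => k _; rewrite rmorphB.
Qed.

End MorphismChainSum.

Lemma eq_chain_sum (R : comNzRingType) r n (x y : 'I_r -> R) al be :
  x =1 y -> al =1 be -> chain_sum n x al = chain_sum n y be.
Proof.
move=> xy ab; apply: eq_bigr => i _; apply: eq_bigr => j _.
by apply: eq_bigr => k _; rewrite xy ab.
Qed.

(** In the remainder formula the variables enter only through a commutative product. *)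
Lemma chain_sum_perm (R : comNzRingType) r n (x : 'I_r -> R) al (s : 'S_r) :
  (0 < n)%N -> chain_sum n (x \o s) al = chain_sum n x al.
Proof.
move=> n_gt0; rewrite !chain_sumE //; congr (rmodp _ _)`__.
by rewrite [RHS](reindex_inj (@perm_inj _ s)).
Qed.

Lemma eq_newton_chain_sum (R : comNzRingType) r n (x : 'I_r -> R) al be :
  (0 < n)%N -> newton al n = newton be n -> chain_sum n x al = chain_sum n x be.
Proof. by move=> n_gt0 e; rewrite !chain_sumE // e. Qed.

(** * Transfer to the polynomials [fa] *)

Section Fa.
Variable K : fieldType.

Lemma faE r n (alpha : n.-tuple K) :
  fa r alpha = chain_sum n (fun j => 'X_j) (fun k => (alpha`_k)%:MP).
Proof.
apply: eq_bigr => i _; apply: eq_bigr => j _.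
by apply: eq_bigr => k _; rewrite (tnth_nth 0).
Qed.

Lemma newton_mpolyC r n (alpha : n.-tuple K) :
  newton (fun k => (alpha`_k)%:MP_[r]) n =
  map_poly (@mpolyC r K) (\prod_(k < n) ('X - (tnth alpha k)%:P)).
Proof.
rewrite rmorph_prod; apply: eq_bigr => k _.
by rewrite rmorphB /= map_polyX map_polyC (tnth_nth 0).
Qed.

Lemma fa_rec r n (alpha : n.-tuple K) (l : 'I_r) : (2 <= n)%N ->
  fa r alpha =
    (\prod_(j < r | j != l) ('X_j - (head 0 alpha)%:MP))
      * fa r [tuple of behead alpha]
    + (\prod_(k < n | (1 <= k)%N) ('X_l - (tnth alpha k)%:MP))
      * (fa r.-1 alpha \mPo [tuple 'X_(lift l j) | j < r.-1]).
Proof.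
case: r l => [|r] l; first by case: l.
case: n alpha => [|n] alpha //; rewrite ltnS => n_gt0.
rewrite !faE (@chain_sum_rec _ _ _ _ _ l) //; congr (_ * _ + _ * _).
- rewrite (reindex_omap (lift l) (unlift l)) /= => [|j].
    apply: eq_big => j; first by rewrite liftK eq_sym neq_lift eqxx.
    by rewrite nth0.
  by case: unliftP => [k ->|->]; rewrite ?eqxx.
- by apply: eq_chain_sum => // k; rewrite /= nth_behead.
- rewrite [RHS]big_mkcond big_ord_recl /= mul1r.
  by apply: eq_bigr => k _; rewrite (tnth_nth 0).
rewrite rmorph_chain_sum; apply: eq_chain_sum => [j|k] /=.
  by rewrite comp_mpolyXU -tnth_nth tnth_mktuple.
by rewrite comp_mpolyC.
Qed.

Lemma fa_sym r n (alpha : n.-tuple K) : (0 < n)%N -> fa r alpha \is symmetric.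
Proof.
move=> n_gt0; apply/issymP => s; rewrite faE rmorph_chain_sum.
rewrite -[RHS](chain_sum_perm _ _ s) //; apply: eq_chain_sum => [j|k] /=.
  rewrite /msym mmapX mmap1U //.
by rewrite /msym mmapC.
Qed.

Lemma fa_eq r n (alpha beta : n.-tuple K) : (0 < n)%N ->
  \prod_(k < n) ('X - (tnth alpha k)%:P) = \prod_(k < n) ('X - (tnth beta k)%:P) ->
  fa r alpha = fa r beta.
Proof.
move=> n_gt0 e; rewrite !faE; apply: (eq_newton_chain_sum _ n_gt0).
by rewrite !newton_mpolyC e.
Qed.

(** The left-hand side is the fraction form of [fa] for the relabelled tuple [beta], which has the
    same product of linear factors. *)
Lemma fa_perm_fa r n (alpha : n.-tuple K) (sigma : 'S_n) : (0 < n)%N ->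
  fa_perm r (\prod_(k < n) ('X - (tnth alpha k)%:P)) alpha sigma =
  tofrac (fa r alpha).
Proof.
move=> n_gt0; pose beta := [tuple tnth alpha (sigma k) | k < n].
have e : \prod_(k < n) ('X - (tnth alpha k)%:P) =
         \prod_(k < n) ('X - (tnth beta k)%:P).
  rewrite (reindex_inj (@perm_inj _ sigma)).
  by apply: eq_bigr => k _; rewrite tnth_mktuple.
rewrite (fa_eq _ n_gt0 e) fa_frac -e; apply: eq_bigr => i _.
apply: eq_bigr => j _; congr (_ / tofrac _).
by apply: eq_bigr => k _; rewrite perm1 tnth_mktuple.
Qed.

Lemma map_polyC_mpoly (F : fieldType) (f : {rmorphism F -> K}) r (p : {poly F}) :
  map_poly (map_mpoly f) (map_poly (@mpolyC r F) p) =
  map_poly (@mpolyC r K) (map_poly f p).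
Proof.
by apply/polyP => d; rewrite !coef_map /= map_mpolyC.
Qed.

Lemma fa_defined_over (F : fieldType) (f : {rmorphism F -> K}) r n
    (alpha : n.-tuple K) (a : {poly F}) : (0 < n)%N ->
  map_poly f a = \prod_(k < n) ('X - (tnth alpha k)%:P) ->
  exists g : {mpoly F[r]}, fa r alpha = map_mpoly f g.
Proof.
move=> n_gt0 ea; pose A := map_poly (@mpolyC r F) a.
have mA : A \is monic.
  apply: monic_map; rewrite -(map_monic f) ea; exact: monic_prod_XsubC.
(* The remainder formula is written over [F]; division by a monic polynomial commutes with the base
   change to [K]. *)
exists (rmodp (\prod_(j < r) divdiff A 'X_j) A)`_n.-1.
rewrite faE chain_sumE // newton_mpolyC -ea -map_polyC_mpoly -coef_map map_rmodp //.
rewrite rmorph_prod; congr (rmodp _ _)`__.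
by apply: eq_bigr => j _; rewrite /= map_divdiff /= map_mpolyX.
Qed.

End Fa.

(** * Descent to the finite field and the four properties *)

Lemma poly_over_codom (F : finFieldType) (K : fieldType) (f : {rmorphism F -> K})
    (p : {poly K}) : (forall d, p`_d \in codom f) ->
  exists q : {poly F}, map_poly f q = p.
Proof.
move=> pf; exists (\poly_(d < size p) iinv (pf d)); apply/polyP => d.
rewrite coef_map coef_poly /=; case: ltnP => [_|le]; first by rewrite f_iinv.
by rewrite rmorph0 nth_default.
Qed.

Theorem theorem3p7 (F : finFieldType) (K : closedFieldType)
    (iota : {rmorphism F -> K}) (Kalg : forall x : K, algebraicOver iota x)
    (r n : nat) (hr : (1 <= r)%N) (hn : (1 <= n)%N)
    (a : {poly K}) (alpha : n.-tuple K)
    (ha : a = \prod_(k < n) ('X - (tnth alpha k)%:P)) :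
  [/\ (2 <= r)%N -> (2 <= n)%N -> forall l : 'I_r,
        fa r alpha =
          (\prod_(j < r | j != l) ('X_j - (head 0 alpha)%:MP))
            * fa r [tuple of behead alpha]
          + (\prod_(k < n | (1 <= k)%N) ('X_l - (tnth alpha k)%:MP))
            * (fa r.-1 alpha \mPo [tuple 'X_(lift l j) | j < r.-1]),
      fa r alpha \is symmetric,
      forall sigma : 'S_n, tofrac (fa r alpha) = fa_perm r a alpha sigma
    & (forall d : nat, a`_d \in codom iota) ->
        forall m : 'X_{1..r}, (fa r alpha)@_m \in codom iota].
Proof.
split=> [_ n_gt1 l||sigma|aF m].
- exact: fa_rec.
- exact: fa_sym.
- by rewrite ha fa_perm_fa.
have [b eb] := poly_over_codom aF.
have [g ->] := fa_defined_over r hn (etrans eb ha).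
by rewrite mcoeff_map_mpoly codom_f.
Qed.
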